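(* Let $n\ge 1$ be an integer, let $a_1,\dots,a_n>0$ be real numbers with $\sum_{i=1}^n a_i=1$, and define $S_i=\sum_{j=1}^i a_j$ for $i=1,\dots,n$. Let $g:[0,1]\to\mathbb{R}$ be a decreasing integrable function. Then $$\sum_{i=1}^n a_i\, g(S_i)\le \int_0^1 g(x)\,dx.$$
   Context: ''Decreasing'' is meant in the non-strict sense: $g(y)\le g(x)$ whenever $0\le x\le y\le 1$ (strict monotonicity is called ''strictly decreasing''). *)

(* Defs.v *)
From HB Require Import structures.
From mathcomp Require Export all_boot all_order all_algebra.
From mathcomp Require Export all_classical all_reals all_analysis.
Export numFieldNormedType.Exports.
Export Order.TTheory GRing.Theory Num.Theory.

Set Implicit Arguments.
Unset Strict Implicit.
Unset Printing Implicit Defensive.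

Local Open Scope ring_scope.

(* Indices are shifted by one: for [i : 'I_n], [partial_sum a i] is the
   1-indexed [S_(i+1) = a_1 + ... + a_(i+1)], so the i-th term is included. *)
Definition partial_sum (R : realType) (n : nat) (a : 'I_n -> R) (i : 'I_n) : R :=
  \sum_(j < n | (j <= i)%N) a j.

(* Main.v *)
(* On each subinterval ]S_(i-1), S_i], of length a_i, the decreasing function g
   is at least its value g(S_i) at the right endpoint; summing over i gives the
   inequality. *)
Require Import Defs.
From mathcomp Require Import all_boot all_order all_algebra.
From mathcomp Require Import all_classical all_reals all_analysis.
Import numFieldNormedType.Exports.
Import Order.TTheory GRing.Theory Num.Theory.

Set Implicit Arguments.
Unset Strict Implicit.
Unset Printing Implicit Defensive.

Local Open Scope classical_set_scope.
Local Open Scope ring_scope.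

(** With [S_0 = 0], the left side is the right-endpoint Riemann sum of [g] for the partition
    [0 = S_0 < ... < S_n = 1]; since [g] decreases, it is a lower sum.
    [nonincreasing_Rintegral_itv_ge] bounds one cell, and [nonincreasing_right_sum_le] adds the
    cells up by induction. *)

Lemma nonincreasing_Rintegral_itv_ge (R : realType) (g : R -> R) (c d : R) :
  c <= d -> {in `[c, d] &, nonincreasing_fun g} ->
  lebesgue_measure.-integrable `]c, d] (EFin \o g) ->
  (d - c) * g d <= \int[lebesgue_measure]_(x in `]c, d]) g x.
Proof.
move=> cd gd gi.
have -> : (d - c) * g d = \int[lebesgue_measure]_(x in `]c, d]) g d.
  rewrite Rintegral_cst//= lebesgue_measure_itv/= lte_fin mulrC.
  (* The measure of the interval is a conditional on [c < d]; when [c = d] both sides vanish. *)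
  by case: ltgtP cd => //= -> _; rewrite subrr.
apply: le_Rintegral => //.
- apply: measurable_bounded_integrable => //=.
  + by rewrite lebesgue_measure_itv/=; case: ifP; rewrite -?EFinD ltry.
  + exact: bounded_cst.
- move=> x /=; rewrite in_itv/= => /andP[cx xd].
  by apply: gd => //; rewrite in_itv/= ?cd ?lexx// (ltW cx) xd.
Qed.

(** Induction on [m], peeling off the last cell. Indexing the nodes by [nat] supplies the left
    endpoint [s 0] and lets the partition be truncated. *)
Lemma nonincreasing_right_sum_le (R : realType) (g : R -> R) (s : nat -> R)
    (m : nat) :
  {homo s : i j / (i <= j)%N >-> i <= j} ->
  {in `[s 0, s m] &, nonincreasing_fun g} ->
  lebesgue_measure.-integrable `[s 0, s m] (EFin \o g) ->
  \sum_(i < m) (s i.+1 - s i) * g (s i.+1)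
    <= \int[lebesgue_measure]_(x in `[s 0, s m]) g x.
Proof.
move=> s_homo; elim: m => [|m IHm] gd gi.
  by rewrite big_ord0 set_itv1 Rintegral_set1.
have s0m : s 0 <= s m by exact: s_homo.
have smS : s m <= s m.+1 by exact: s_homo.
have sub1 : `[s 0, s m] `<=` `[s 0, s m.+1].
  by apply: subset_itvl; rewrite bnd_simp.
have sub2 : `[s m, s m.+1] `<=` `[s 0, s m.+1].
  by apply: subset_itvr; rewrite bnd_simp.
have sub3 : `]s m, s m.+1] `<=` `[s 0, s m.+1].
  by apply: subset_itvr; rewrite bnd_simp.
(* Subtract and add back the integral up to [s m]: the difference is the integral over the half-open
   cell []s m, s m.+1]]. *)
rewrite big_ord_recr/= -(subrK (\int[lebesgue_measure]_(x in `[s 0, s m]) g x)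
  (\int[lebesgue_measure]_(x in `[s 0, s m.+1]) g x)).
rewrite Rintegral_itvB ?bnd_simp// addrC lerD//.
- apply: nonincreasing_Rintegral_itv_ge => //.
    by move=> x y xs ys; apply: gd; exact: sub2.
  exact: integrableS gi.
- apply: IHm; last exact: integrableS gi.
  by move=> x y xs ys; apply: gd; exact: sub1.
Qed.

Theorem theorem2p1 (R : realType) (n : nat) (a : 'I_n -> R) (g : R -> R)
  (n_ge1 : (1 <= n)%N)
  (a_gt0 : forall i, 0 < a i)
  (a_sum1 : \sum_(i < n) a i = 1)
  (g_decreasing : {in `[0, 1] &, nonincreasing_fun g})
  (g_integrable : lebesgue_measure.-integrable `[0, 1] (EFin \o g)) :
  \sum_(i < n) a i * g (partial_sum a i)
    <= \int[lebesgue_measure]_(x in `[0, 1]) g x.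
Proof.
(* The strict bound makes [s 0] an empty sum, and [s i.+1] is [partial_sum a i] by computation, as
   [j < i.+1] reduces to [j <= i]. *)
pose s k := \sum_(j < n | (j < k)%N) a j.
have s0 : s 0 = 0 by rewrite /s big_pred0.
have sn : s n = 1.
  by rewrite /s -a_sum1; apply: eq_bigl => j; rewrite ltn_ord.
have sS (i : 'I_n) : s i.+1 - s i = a i.
  rewrite /s (bigD1 i)//= (eq_bigl (fun j : 'I_n => (j < i)%N)).
    by rewrite addrK.
  by move=> j; rewrite ltnS [RHS]ltn_neqAle andbC.
have s_homo : {homo s : i j / (i <= j)%N >-> i <= j}.
  move=> i j ij; rewrite /s big_mkcond [leRHS]big_mkcond ler_sum// => k _.
  case: ifPn => [ki|_]; first by rewrite (leq_trans ki ij).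
  by case: ifP => // _; exact: ltW.
have := @nonincreasing_right_sum_le R g s n s_homo.
rewrite s0 sn => /(_ g_decreasing g_integrable); apply: le_trans.
by apply: ler_sum => i _; rewrite sS.
Qed.
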